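(* Let $L$ be a Moufang loop. For each $r\ge1$, let $T$ be a bracketing of an $r$-fold product, and let $T^\ast$ denote its mirror bracketing. Then for any subsets $X_1,\dots,X_r\subseteq L$ one has $T(X_1,\dots,X_r)^{-1}=T^\ast(X_r^{-1},\dots,X_1^{-1})$. Consequently, if $A\subseteq L$ satisfies $A=A^{-1}$, then for every bracketing $T$ of an $r$-fold product, $|T(A,\dots,A)|=|T^\ast(A,\dots,A)|$.
   Context: A loop is a set with a binary operation having a two-sided identity $1$ such that for all $a,b$ the equations $ax=b$ and $ya=b$ have unique solutions. A Moufang loop is a loop satisfying $(xy)(zx)=(x(yz))x$ for all $x,y,z$; every element $x$ of it has a unique two-sided inverse $x^{-1}$. For subsets $X,Y$ of a loop, $XY=\{xy:x\in X,y\in Y\}$ and $X^{-1}=\{x^{-1}:x\in X\}$. Bracketings are defined recursively: for $r=1$ there is a unique bracketing, with $T(X_1)=X_1$ and $T^\ast=T$; for $r\ge2$ a bracketing is a pair $T=(U,V)$ with $U$ a bracketing of $k$ variables and $V$ a bracketing of $r-k$ variables for some $1\le k\le r-1$, with $T(X_1,\dots,X_r)=U(X_1,\dots,X_k)\,V(X_{k+1},\dots,X_r)$, and its mirror is $T^\ast=(V^\ast,U^\ast)$ (left and right interchanged at every binary node). *)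

(* Defs.v *)
From HB Require Import structures.
From mathcomp Require Import all_boot all_classical.

Set Implicit Arguments.
Unset Strict Implicit.
Unset Printing Implicit Defensive.

Local Open Scope classical_set_scope.
Local Open Scope group_scope.

HB.mixin Record BaseUMagma_isLoop G of BaseUMagma G := {
  loop_mul1g : left_id 1 (@mul G);
  loop_mulg1 : right_id 1 (@mul G);
  loop_ldiv : forall a b : G, exists! x : G, a * x = b;
  loop_rdiv : forall a b : G, exists! y : G, y * a = b
}.

#[short(type="loopType")]
HB.structure Definition Loop := {G of BaseUMagma_isLoop G & BaseUMagma G}.

HB.mixin Record Loop_isMoufang G of Loop G := {
  moufang : forall x y z : G, (x * y) * (z * x) = (x * (y * z)) * x
}.

#[short(type="moufangLoopType")]
HB.structure Definition MoufangLoop := {G of Loop_isMoufang G & Loop G}.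

Section MoufangInverse.

Variable L : moufangLoopType.
Implicit Types x y : L.

Lemma moufang_inv_subproof x : exists y, x * y = 1 /\ y * x = 1.
Proof.
have mulgI (a u v : L) : a * u = a * v -> u = v.
  by have [w [_ wP]] := loop_ldiv a (a * v); move=> /wP <-; apply: wP.
have mulIg (a u v : L) : u * a = v * a -> u = v.
  by have [w [_ wP]] := loop_rdiv a (v * a); move=> /wP <-; apply: wP.
have [r [xr _]] := loop_ldiv x 1.
exists r; split=> //; apply: (mulgI x); rewrite loop_mulg1.
by apply: (mulIg x); rewrite -moufang xr loop_mul1g.
Qed.

Definition moufang_inv x : L := projT1 (cid (moufang_inv_subproof x)).

Lemma moufang_mulgV x : x * moufang_inv x = 1.
Proof. by rewrite /moufang_inv; case: cid => y []. Qed.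

Lemma moufang_mulVg x : moufang_inv x * x = 1.
Proof. by rewrite /moufang_inv; case: cid => y []. Qed.

Lemma moufang_inv_uniq x y : x * y = 1 -> y = moufang_inv x.
Proof.
have [w [_ wP]] := loop_ldiv x 1.
by move=> /wP <-; apply: wP; apply: moufang_mulgV.
Qed.

End MoufangInverse.

Definition setmul (G : magmaType) (X Y : set G) : set G :=
  [set x * y | x in X & y in Y].

Definition setinv (L : moufangLoopType) (X : set L) : set L :=
  @moufang_inv L @` X.

(* [bracketing r] has no inhabitant for r = 0, so in [BNode] both k and l are
   positive. Carrying the equation k + l = r, rather than using the index
   k + l, lets [mirror] preserve the index without a cast. *)
Inductive bracketing : nat -> Type :=
| BLeaf : bracketing 1
| BNode (r k l : nat) (e : k + l = r) (U : bracketing k) (V : bracketing l) :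
    bracketing r.

Fixpoint mirror (r : nat) (T : bracketing r) : bracketing r :=
  match T in bracketing r0 return bracketing r0 with
  | BLeaf => BLeaf
  | BNode r k l e U V => BNode (etrans (addnC l k) e) (mirror V) (mirror U)
  end.

(* Indices start at 0: X_1, ..., X_r is [X : 'I_r -> set G]. *)
Fixpoint bracket_eval (G : magmaType) (r : nat) (T : bracketing r) :
    ('I_r -> set G) -> set G :=
  match T in bracketing r0 return ('I_r0 -> set G) -> set G with
  | BLeaf => fun X => X ord0
  | BNode r k l e U V => fun X =>
      setmul (bracket_eval U (fun i : 'I_k => X (cast_ord e (lshift l i))))
             (bracket_eval V (fun j : 'I_l => X (cast_ord e (rshift k j))))
  end.

(* Main.v *)
Require Import Defs.
From HB Require Import structures.
From mathcomp Require Import all_boot all_classical.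
From mathcomp Require Import zify.

Set Implicit Arguments.
Unset Strict Implicit.
Unset Printing Implicit Defensive.

Local Open Scope classical_set_scope.
Local Open Scope card_scope.

(** In a Moufang loop inversion is an involutive anti-automorphism: the Moufang
    identity with [y] or [z] equal to [x^-1] gives the left and right inverse
    properties [x (x^-1 z) = z] and [(y x^-1) x = y], and these yield
    [(x y)^-1 = y^-1 x^-1]. Hence inverting a product set reverses its two
    factors, and the first claim follows by induction on the bracketing. When
    [A] is symmetric, inversion is then a bijection from [T(A, ..., A)] onto
    the mirrored product set. *)

Section MoufangLoopTheory.

Local Open Scope group_scope.

Variable L : moufangLoopType.
Implicit Types (x y z : L) (X Y : set L).

Lemma loop_mulgI x : injective (fun y => x * y).
Proof.
move=> y z /= eq_xyz; have [w [_ wP]] := loop_ldiv x (x * z).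
exact: etrans (esym (wP y eq_xyz)) (wP z erefl).
Qed.

Lemma loop_mulIg x : injective (fun y => y * x).
Proof.
move=> y z /= eq_yzx; have [w [_ wP]] := loop_rdiv x (z * x).
exact: etrans (esym (wP y eq_yzx)) (wP z erefl).
Qed.

Lemma moufang_invK : involutive (@moufang_inv L).
Proof. by move=> x; apply/esym/moufang_inv_uniq/moufang_mulVg. Qed.

Lemma moufang_mulVKg x z : x * (moufang_inv x * z) = z.
Proof.
by apply: (@loop_mulIg x); rewrite -moufang moufang_mulgV loop_mul1g.
Qed.

Lemma moufang_mulKg x z : moufang_inv x * (x * z) = z.
Proof. by rewrite -{2}(moufang_invK x) moufang_mulVKg. Qed.

(** The Moufang identity with [1] as its first inner factor. *)
Lemma moufang_flexible x y : x * (y * x) = (x * y) * x.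
Proof. by rewrite -{1}(loop_mulg1 x) moufang loop_mul1g. Qed.

Lemma moufang_mulgVK x y : (y * moufang_inv x) * x = y.
Proof.
apply: (@loop_mulgI x).
(* [x ((y x^-1) x) = (x (y x^-1)) x = (x y) (x^-1 x) = x y]. *)
by rewrite moufang_flexible -moufang moufang_mulVg loop_mulg1.
Qed.

Lemma moufang_mulgK x y : (y * x) * moufang_inv x = y.
Proof. by rewrite -{1}(moufang_invK x) moufang_mulgVK. Qed.

Lemma moufang_invM x y :
  moufang_inv (x * y) = moufang_inv y * moufang_inv x.
Proof.
(* Cancel [x y] on the right in [x^-1 (x y) = y]. *)
have -> : moufang_inv x = y * moufang_inv (x * y).
  by rewrite -{1}(moufang_mulgK (x * y) (moufang_inv x)) moufang_mulKg.
by rewrite moufang_mulKg.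
Qed.

Lemma setinv_setmul X Y : setinv (setmul X Y) = setmul (setinv Y) (setinv X).
Proof.
apply/seteqP; split=> w.
- move=> [_ [x Xx [y Yy <-]] <-]; rewrite moufang_invM.
  by exists (moufang_inv y); [exists y | exists (moufang_inv x); [exists x|]].
- move=> [_ [y Yy <-] [_ [x Xx <-] <-]].
  by exists (x * y); [exists x => //; exists y | rewrite moufang_invM].
Qed.

Lemma card_setinv X : setinv X #= X.
Proof. by apply: inj_card_eq => x y _ _; apply: inv_inj; exact: moufang_invK. Qed.

Lemma setinv_bracket_eval (r : nat) (T : bracketing r) (X : 'I_r -> set L) :
  setinv (bracket_eval T X)
    = bracket_eval (mirror T) (fun i : 'I_r => setinv (X (rev_ord i))).
Proof.
elim: T X => [|{}r k l e U IHU V IHV] X /=.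
  by congr (setinv (X _)); apply: val_inj.
(* Reversal swaps the two index blocks and reverses each: [r-1-j = k + (l-1-j)] for [j < l], and
   [r-1-(l+i) = k-1-i] for [i < k]. *)
rewrite setinv_setmul IHU IHV; congr setmul; congr bracket_eval;
  apply/funext => i; congr (setinv (X _)); apply: val_inj => /=;
  have := ltn_ord i; lia.
Qed.

End MoufangLoopTheory.

Theorem proposition3p11 (L : moufangLoopType) :
  (forall (r : nat) (hr : (0 < r)%N) (T : bracketing r) (X : 'I_r -> set L),
     setinv (bracket_eval T X)
       = bracket_eval (mirror T) (fun i : 'I_r => setinv (X (rev_ord i))))
  /\
  (forall A : set L, A = setinv A ->
     forall (r : nat) (hr : (0 < r)%N) (T : bracketing r),
       bracket_eval T (fun _ : 'I_r => A)
         #= bracket_eval (mirror T) (fun _ : 'I_r => A)).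
Proof.
split=> [r _ T X|A symA r _ T]; first exact: setinv_bracket_eval.
(* A constant family is unchanged by index reversal, so replacing [A] by [setinv A] on the right
   alone exhibits that side as the inverse of the left. *)
rewrite [in X in _ #= X]symA -(setinv_bracket_eval T (fun=> A)).
by rewrite card_eq_sym; exact: card_setinv.
Qed.
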